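(* Let $m\in\mathbb{N}$ with $m\geq 2$. Then the Baumslag--Solitar semigroup $\mathrm{S}(m,m)$ contains finitely generated subsemigroups that are neither right-automatic nor left-automatic.
   Context: $\mathbb{N}$ denotes the set of positive integers. For $m\in\mathbb{N}$, the Baumslag--Solitar semigroup $\mathrm{S}(m,m)$ is the semigroup defined by the semigroup presentation with generators $x,y$ and the single defining relation $yx^m=x^my$. Elements are represented by words over $\{x,y\}$. The empty word is not included in the presented semigroup. For an alphabet $A$, $A^+$ is the set of nonempty words over $A$ and $\varepsilon$ is the empty word. If $A$ is an alphabet representing a set of generators for a semigroup $S$, then for $w\in A^+$, $\overline{w}$ denotes the element of $S$ represented by $w$, and $\overline{W}=\{\overline{w}: w\in W\}$ for $W\subseteq A^+$. Let $\$$ be a symbol not in $A$ and let $A(2,\$)=\{(a,b): a,b\in A\cup\{\$\}\}\setminus\{(\$,\$)\}$, regarded as an alphabet. The map $\delta_A: A^+\times A^+\to A(2,\$)^+$ (written on the right) sends $(u_1\cdots u_p,\,v_1\cdots v_q)$, with $u_i,v_i\in A$, to the word of length $\max(p,q)$ whose $i$-th letter is $(u_i,v_i)$, where $u_i$ is taken to be $\$$ for $i>p$ and $v_i$ is taken to be $\$$ for $i>q$ (so padding is placed on the right). A right-automatic (respectively left-automatic) structure for a semigroup $S$ is a pair $(A,L)$ where $A$ is a finite alphabet representing a set of generators for $S$ and $L\subseteq A^+$ is a regular language with $\overline{L}=S$ such that, for each $a\in A\cup\{\varepsilon\}$, the language $L_a=\{(u,v): u,v\in L,\ \overline{ua}=\overline{v}\}\delta_A$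 (respectively ${}_aL=\{(u,v): u,v\in L,\ \overline{au}=\overline{v}\}\delta_A$) is regular over $A(2,\$)$. A semigroup is right-automatic (respectively left-automatic) if it admits a right-automatic (respectively left-automatic) structure. *)

(* Defs.v *)
From HB Require Import structures.
From mathcomp Require Import all_boot.
From mathcomp Require Import boolp classical_sets.

Set Implicit Arguments.
Unset Strict Implicit.
Unset Printing Implicit Defensive.

Local Open Scope group_scope.
Local Open Scope classical_set_scope.
Local Open Scope quotient_scope.

(* A^+: a nonempty word is stored as its first letter and the remaining ones. *)
Definition word (A : Type) : Type := (A * seq A)%type.

HB.instance Definition _ (A : choiceType) :=
  Choice.copy (word A) (A * seq A)%type.

Definition letter (A : Type) (a : A) : word A := (a, [::]).

Definition letters (A : Type) (w : word A) : seq A := w.1 :: w.2.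

Definition wcat (A : Type) (u v : word A) : word A := (u.1, u.2 ++ letters v).

Lemma wcatA (A : Type) : associative (@wcat A).
Proof. by move=> [a u] [b v] [c w]; rewrite /wcat /letters /= -catA. Qed.

HB.instance Definition _ (A : choiceType) :=
  isSemigroup.Build (word A) (@wcatA A).

(* The value in S of a word, the letter a standing for the element f a. *)
Definition eval (A : Type) (S : semigroupType) (f : A -> S) (w : word A) : S :=
  foldl (fun s a => s * f a) (f w.1) w.2.

(* The congruence on A^+ generated by the pairs in R. *)
Inductive congruence (A : Type) (R : word A -> word A -> Prop) :
    word A -> word A -> Prop :=
| cong_rel u v : R u v -> congruence R u v
| cong_refl u : congruence R u u
| cong_sym u v : congruence R u v -> congruence R v u
| cong_trans u v w : congruence R u v -> congruence R v w -> congruence R u w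
| cong_mul u u' v v' : congruence R u u' -> congruence R v v' ->
    congruence R (wcat u v) (wcat u' v').

Section Presentation.
Variables (A : choiceType) (R : word A -> word A -> Prop).

Definition congb : rel (word A) := fun u v => `[< congruence R u v >].

Lemma congb_refl : reflexive congb.
Proof. by move=> u; apply/asboolP/cong_refl. Qed.

Lemma congb_sym : symmetric congb.
Proof. by move=> u v; apply/asboolP/asboolP => /cong_sym. Qed.

Lemma congb_trans : transitive congb.
Proof.
by move=> v u w /asboolP uv /asboolP vw; apply/asboolP/(cong_trans uv vw).
Qed.

Canonical congb_equiv := EquivRel congb congb_refl congb_sym congb_trans.

Definition presented : Type := {eq_quot congb}.

HB.instance Definition _ := Choice.copy presented {eq_quot congb}.
HB.instance Definition _ := Quotient.copy presented {eq_quot congb}.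

Lemma pi_presentedP (u v : word A) :
  \pi_presented u = \pi_presented v <-> congruence R u v.
Proof.
split=> [/(@eqmodP _ congb_equiv)/asboolP //|uv].
by apply/(@eqmodP _ congb_equiv)/asboolP.
Qed.

Definition presented_mul (s t : presented) : presented :=
  \pi_presented (wcat (repr s) (repr t)).

Lemma pi_wcat (u v : word A) :
  \pi_presented (wcat u v) = presented_mul (\pi_presented u) (\pi_presented v).
Proof.
by apply/pi_presentedP/cong_mul; apply/pi_presentedP; rewrite reprK.
Qed.

Lemma presented_mulA : associative presented_mul.
Proof.
move=> s t r; rewrite -[s]reprK -[t]reprK -[r]reprK.
move: (repr s) (repr t) (repr r) => u v w.
by rewrite -(pi_wcat v w) -(pi_wcat u v) -!pi_wcat wcatA.
Qed.

HB.instance Definition _ := isSemigroup.Build presented presented_mulA.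

End Presentation.

Inductive BSgen := BSx | BSy.

Definition BSgen_bool (g : BSgen) : bool := if g is BSx then true else false.
Definition bool_BSgen (b : bool) : BSgen := if b then BSx else BSy.

Lemma BSgen_boolK : cancel BSgen_bool bool_BSgen.
Proof. by case. Qed.

HB.instance Definition _ := Choice.copy BSgen (can_type BSgen_boolK).

(* The single relation y x^m = x^m y, for m > 0: the head of x^m y is split
   off, whence m.-1 (the case m = 0 is meaningless). *)
Definition BSrel (m : nat) (u v : word BSgen) : Prop :=
  u = (BSy, nseq m BSx) /\ v = (BSx, rcons (nseq m.-1 BSx) BSy).

(* The Baumslag--Solitar semigroup S(m,m). *)
Notation BS m := (presented (BSrel m)).

Inductive generated (S : semigroupType) (X : set S) : set S :=
| gen_mem s : X s -> generated X s
| gen_mul s t : generated X s -> generated X t -> generated X (s * t).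

Definition finitely_generated (S : semigroupType) : Prop :=
  exists X : seq S, generated [set` X] = [set: S].

Record dfa (A : finType) := DFA {
  dfa_state : finType;
  dfa_init : dfa_state;
  dfa_trans : dfa_state -> A -> dfa_state;
  dfa_final : {set dfa_state}
}.

Definition dfa_accept (A : finType) (D : dfa A) (w : word A) : bool :=
  foldl (@dfa_trans A D) (dfa_init D) (letters w) \in dfa_final D.

Definition regular (A : finType) (L : set (word A)) : Prop :=
  exists D : dfa A, L = [set w | dfa_accept D w].

(* The alphabet A(2,$), where None plays the part of the padding symbol $. *)
Definition padded (A : finType) :=
  {p : option A * option A | p != (None, None)}.

Section Convolution.
Variable A : finType.

Definition pad_both (a b : A) : padded A := exist _ (Some a, Some b) isT.
Definition pad_left (a : A) : padded A := exist _ (Some a, None) isT.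
Definition pad_right (b : A) : padded A := exist _ (None, Some b) isT.

Fixpoint convolve (u v : seq A) : seq (padded A) :=
  match u, v with
  | a :: u', b :: v' => pad_both a b :: convolve u' v'
  | _, [::] => map pad_left u
  | [::], _ => map pad_right v
  end.

(* The map delta_A. *)
Definition convolution (u v : word A) : word (padded A) :=
  (pad_both u.1 v.1, convolve u.2 v.2).

End Convolution.

Section Automatic.
Variables (S : semigroupType) (A : finType) (f : A -> S) (L : set (word A)).

(* The languages L_a and _aL; a = None stands for the empty word. *)
Definition right_lang (a : option A) : set (word (padded A)) :=
  [set w | exists u v, [/\ L u, L v,
     eval f (if a is Some b then u * letter b else u) = eval f v
     & w = convolution u v]].

Definition left_lang (a : option A) : set (word (padded A)) :=
  [set w | exists u v, [/\ L u, L v,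
     eval f (if a is Some b then letter b * u else u) = eval f v
     & w = convolution u v]].

Definition right_automatic_structure : Prop :=
  [/\ generated (range f) = [set: S], regular L, eval f @` L = [set: S]
    & forall a : option A, regular (right_lang a)].

Definition left_automatic_structure : Prop :=
  [/\ generated (range f) = [set: S], regular L, eval f @` L = [set: S]
    & forall a : option A, regular (left_lang a)].

End Automatic.

Definition right_automatic (S : semigroupType) : Prop :=
  exists (A : finType) (f : A -> S) (L : set (word A)),
    right_automatic_structure f L.

Definition left_automatic (S : semigroupType) : Prop :=
  exists (A : finType) (f : A -> S) (L : set (word A)),
    left_automatic_structure f L.

(* Main.v *)
Require Import Defs.
From HB Require Import structures.
From mathcomp Require Import all_boot.
From mathcomp Require Import boolp classical_sets.
From mathcomp Require Import zify.

Set Implicit Arguments.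
Unset Strict Implicit.
Unset Printing Implicit Defensive.

(** The power z = x^m is central in S(m,m), so a product of factors y x^a is
known as soon as one knows the sequence of the exponents a modulo m and the
total number of letters x.  Use only the residues 0 and 1: an element then
reads as a binary word together with a number of x, and z changes the number
without changing the word.

Let T be generated by the seven elements

  p : 11,  q : 110,  r : 011,  b : 01,  e : 10,  b' : 00,  e' : 00,

where b and e' carry an extra factor z.  The word 11 (01)^i (00)^(i+1) 11 with
i extra factors z has two factorizations in T (two_factorizations):

  g = p b^i b'^(i+1) p = q e^i e'^i r.

In the block (01)^i the first collects one factor z in each step and the
second collects none; the second makes up for it in the block of zeros.

An element of T whose word avoids 11 has even length (generators
without 11 have length 2), so a factorization of g cuts the alternating block
always at even places or always at odd places.  The pieces cut out there are
(01)^c with c factors z, or (10)^c with none (tame): one calls this the phase of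
the factorization.  If a regular language of pairs (u, v) forces the values of u
and v to differ by a fixed multiplication, pumping inside the alternating
block lengthens both values by the same number of letters, and must add the
same number of x; hence u and v have the same phase (phase_unique).

For an arbitrary structure (A, L), the indecomposable elements p, q, r
are values of letters.  On the right, take h and k with h p = g and k r = g:
their words have even and odd length, so every representative of h
has the phase of b and every representative of k has the phase of e.
A representative of g would share its phase with both.  On the left the same
happens with p h = g and q k = g.  Pumping takes place among the first letters
of the words, so the padding on the right is harmless in both cases. *)

(** * Convolutions and pumping *)

Section Convolution.
Variable A : finType.
Implicit Types (s t : seq A) (u v : word A).

Lemma letters_convolution u v :
  letters (convolution u v) = convolve (letters u) (letters v).
Proof. by []. Qed.

Lemma convolve_cat s1 s2 t1 t2 : size s1 = size t1 ->
  convolve (s1 ++ s2) (t1 ++ t2) = convolve s1 t1 ++ convolve s2 t2.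
Proof. by elim: s1 t1 => [|a s1 IH] [|b t1] //= [/IH->]. Qed.

Lemma convolveK1 s t : pmap (fun p => (sval p).1) (convolve s t) = s.
Proof.
elim: s t => [|a s IH] [|b t] //=; last by rewrite IH.
- by elim: t => //.
- by congr cons; elim: s {IH} => //= c s ->.
Qed.

Lemma convolveK2 s t : pmap (fun p => (sval p).2) (convolve s t) = t.
Proof.
elim: s t => [|a s IH] [|b t] //=; last by rewrite IH.
- by congr cons; elim: t => //= c s ->.
- by elim: s {IH} => //.
Qed.

Lemma letters_inj : injective (@letters A).
Proof. by move=> [a s] [b t] [-> ->]. Qed.

Lemma convolution_inj u v u' v' :
  convolution u v = convolution u' v' -> u = u' /\ v = v'.
Proof.
move=> /(congr1 (@letters _)); rewrite !letters_convolution => E.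
by split; apply: letters_inj;
  rewrite -1?[letters _](convolveK1 _ (letters v)) ?E ?convolveK1
          -1?[letters v](convolveK2 (letters u) _) ?E ?convolveK2.
Qed.

End Convolution.

(** The pumped block s2 does not contain the first letter, and it lies within
the first n letters. *)
Definition pumped (A : Type) (n : nat) (u u' : word A) : Prop :=
  exists s1 s2 s3, [/\ 0 < size s1, 0 < size s2, size (s1 ++ s2) <= n,
    letters u = s1 ++ s2 ++ s3 & letters u' = s1 ++ s2 ++ s2 ++ s3].

(** Positions i < j of the tail of u delimit the block. *)
Lemma pumpedI (A : Type) (n i j : nat) (u : word A) :
    i < j <= n -> n <= size u.2 ->
  pumped n.+1 u (u.1, take j u.2 ++ drop i u.2).
Proof.
move=> /andP[ij jn] nu; have ju := leq_trans jn nu.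
have Etake : take j u.2 = take i u.2 ++ drop i (take j u.2).
  by rewrite -{1}(cat_take_drop i (take j u.2)) take_takel // ltnW.
have Edrop : drop i u.2 = drop i (take j u.2) ++ drop j u.2.
  rewrite -{1}(cat_take_drop j u.2) drop_cat size_take_min.
  by rewrite (minn_idPl ju) ij.
exists (u.1 :: take i u.2), (drop i (take j u.2)), (drop j u.2).
split=> //=.
- by rewrite size_drop size_takel // subn_gt0.
- by rewrite -Etake size_takel.
- by rewrite -Edrop cat_take_drop; case: u {nu ju Etake Edrop}.
- by rewrite /letters /= {1}Etake Edrop -!catA.
Qed.

(** Both components are long, hence the automaton reads only unpadded pairs in
its first steps: a repeated state there pumps both words at the same place. *)
Lemma regular_pumping (A : finType) (M : set (word (padded A))) : regular M ->
  exists n, forall u v, M (convolution u v) ->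
    n <= size u.2 -> n <= size v.2 ->
  exists u' v', [/\ M (convolution u' v'), pumped n.+1 u u' & pumped n.+1 v v'].
Proof.
move=> [D ->]; set run := foldl (@dfa_trans _ D).
(* The first letter is read beforehand, so that it stays out of the loop. *)
exists #|dfa_state D| => u v; set n := #|_| => acc nu nv.
pose q (i : 'I_n.+1) := run (run (dfa_init D) [:: pad_both u.1 v.1])
  (convolve (take i u.2) (take i v.2)).
have [i [j [ij qij]]] : exists i j : 'I_n.+1, i < j /\ q i = q j.
  have /injectivePn[i [j ij qij]] : ~~ injectiveb q.
    by apply/injectiveP => /leq_card; rewrite card_ord ltnn.
  have /orP[lij|lji] : (i < j) || (j < i) by rewrite -neq_ltn.
    by exists i, j.
  by exists j, i.
have jn : j <= n by rewrite -ltnS.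
have le_i : i <= n by rewrite ltnW // (leq_trans ij).
exists (u.1, take j u.2 ++ drop i u.2), (v.1, take j v.2 ++ drop i v.2).
have uij w : n <= size w.2 -> pumped n.+1 w (w.1, take j w.2 ++ drop i w.2).
  by move=> nw; apply: pumpedI; rewrite ?ij.
split; [|exact: uij|exact: uij].
have size_take_uv k : k <= n -> size (take k u.2) = size (take k v.2).
  by move=> kn; rewrite !size_takel // ?(leq_trans kn).
move: acc; rewrite /= /dfa_accept -/run !letters_convolution /=.
rewrite convolve_cat ?size_take_uv // /run foldl_cat -/run.
rewrite -[run _ (convolve (take j _) _)]qij /q /run -foldl_cat.
by rewrite -convolve_cat ?size_take_uv // !cat_take_drop.
Qed.

(** * Alternating binary words *)

(** The word (e, ~~ e, e, ...) of length n is traject negb e n. *)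
Lemma traject_negb_cat e n (x y post : seq bool) :
    traject negb e n ++ post = x ++ y -> size x <= n ->
  x = traject negb e (size x) /\
  y = traject negb (odd (size x) (+) e) (n - size x) ++ post.
Proof.
have iter_negb k c : iter k negb c = odd k (+) c.
  by elim: k => //= k ->; rewrite addNb.
move=> E xn; move: E; rewrite -{1}(subnKC xn) trajectD -catA iter_negb.
by move/eqP; rewrite eqseq_cat ?size_traject // => /andP[/eqP-> /eqP->].
Qed.

(** The condition sorted nand w says that w has no factor 11. *)
Definition nand (a b : bool) := ~~ (a && b).

Lemma sorted_nand_traject e n : sorted nand (traject negb e n).
Proof.
elim: n e => [|[|n] IH] e //=; move: (IH (~~ e)) => /= ->.
by case: e.
Qed.

Lemma catIs (A : eqType) (s : seq A) : injective (cat^~ s).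
Proof.
move=> x y /= E; have Exy : size x = size y.
  by have /eqP := congr1 size E; rewrite !size_cat eqn_add2r => /eqP.
by move/eqP: E; rewrite eqseq_cat // => /andP[/eqP].
Qed.

Lemma sorted_nand_nseq s n : sorted nand s -> sorted nand (s ++ nseq n false).
Proof.
move=> s_nand; elim: n => [|n IH]; first by rewrite cats0.
rewrite -addn1 nseqD catA; case: (s ++ nseq n false) IH => [//|b s' /= s'_nand].
by rewrite cat_path s'_nand /= /nand andbF.
Qed.

(** * Membership in the languages of a structure *)

Section Eval.
Variables (A : finType) (T : semigroupType) (f : A -> T).

Lemma eval_mul (u v : word A) : eval f (u * v)%g = (eval f u * eval f v)%g.
Proof.
case: u v => a s [b t]; rewrite /eval /= foldl_cat /=.
elim/last_ind: t => [|t c IH] //=.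
by rewrite !foldl_rcons IH mulgA.
Qed.

Lemma right_langP (L : set (word A)) a u v :
  right_lang f L (Some a) (convolution u v) <->
  [/\ L u, L v & (eval f u * f a)%g = eval f v].
Proof.
split=> [[u' [v' [Lu Lv E /convolution_inj[-> ->]]]]|[Lu Lv E]].
  by split=> //; rewrite -E eval_mul.
by exists u, v; split=> //; rewrite eval_mul.
Qed.

Lemma left_langP (L : set (word A)) a u v :
  left_lang f L (Some a) (convolution u v) <->
  [/\ L u, L v & (f a * eval f u)%g = eval f v].
Proof.
split=> [[u' [v' [Lu Lv E /convolution_inj[-> ->]]]]|[Lu Lv E]].
  by split=> //; rewrite -E eval_mul.
by exists u, v; split=> //; rewrite eval_mul.
Qed.

End Eval.

(** * Phases of representatives *)

(** For t in T, pr t is the binary word of t and wt t its number of x. By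
wt_traject, an alternating element costs cost e x for every two of its
letters, and this cost reveals its first letter e. *)
Section Core.
Variables (T : semigroupType) (pr : T -> seq bool) (wt : T -> nat).
Variable cost : bool -> nat.
Hypothesis cost_inj : injective cost.
Hypothesis prM : forall s t : T, pr (s * t)%g = pr s ++ pr t.
Hypothesis wtM : forall s t : T, wt (s * t)%g = wt s + wt t.
Hypothesis pr_gt0 : forall t, 0 < size (pr t).
Hypothesis pr_even : forall t, sorted nand (pr t) -> ~~ odd (size (pr t)).
Hypothesis wt_traject : forall t e, pr t = traject negb e (size (pr t)) ->
  (wt t).*2 = cost e * size (pr t).

Section Letters.
Variables (A : finType) (f : A -> T).

Definition spell (s : seq A) : seq bool := flatten [seq pr (f a) | a <- s].
Definition weigh (s : seq A) : nat := sumn [seq wt (f a) | a <- s].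

Lemma spell_cat s t : spell (s ++ t) = spell s ++ spell t.
Proof. by rewrite /spell map_cat flatten_cat. Qed.

Lemma weigh_cat s t : weigh (s ++ t) = weigh s + weigh t.
Proof. by rewrite /weigh map_cat sumn_cat. Qed.

Lemma pr_eval (w : word A) : pr (eval f w) = spell (letters w).
Proof.
case: w => a s; rewrite /eval /letters /=.
elim/last_ind: s => [|s b IH]; first by rewrite /spell /= cats0.
by rewrite foldl_rcons prM IH -rcons_cons -cats1 spell_cat /spell /= cats0.
Qed.

Lemma wt_eval (w : word A) : wt (eval f w) = weigh (letters w).
Proof.
case: w => a s; rewrite /eval /letters /=.
elim/last_ind: s => [|s b IH]; first by rewrite /weigh /= addn0.
by rewrite foldl_rcons wtM IH -rcons_cons -cats1 weigh_cat /weigh /= addn0.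
Qed.

Lemma spell_even s : sorted nand (spell s) -> ~~ odd (size (spell s)).
Proof. by case: s => // a s; rewrite -(pr_eval (a, s)); apply: pr_even. Qed.

Lemma weigh_traject s e : spell s = traject negb e (size (spell s)) ->
  (weigh s).*2 = cost e * size (spell s).
Proof.
case: s => [|a s]; first by rewrite muln0.
by rewrite -(pr_eval (a, s)) -(wt_eval (a, s)); apply: wt_traject.
Qed.

Lemma spell_gt0 s : 0 < size s -> 0 < size (spell s).
Proof. by case: s => // a s _; rewrite -(pr_eval (a, s)). Qed.

Definition width := \max_(a : A) size (pr (f a)).

Lemma size_pr a : size (pr (f a)) <= width.
Proof. exact: (@leq_bigmax _ (fun a => size (pr (f a)))). Qed.

Lemma size_spell s : size (spell s) <= width * size s.
Proof.
elim: s => [|a s IH]; first by rewrite muln0.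
by rewrite -cat1s spell_cat size_cat mulnS leq_add // /spell /= cats0 size_pr.
Qed.

(** The prefix s1 is alternating, thus avoids 11 and has even length: a
piece of an alternating block starts with the same letter as the block. *)
Lemma spell_segment e L post s1 s2 s3 :
    spell (s1 ++ s2 ++ s3) = traject negb e L ++ post ->
    width * size (s1 ++ s2) <= L ->
  spell s2 = traject negb e (size (spell s2)).
Proof.
rewrite !spell_cat => /esym E /(leq_trans (size_spell _)) L12.
have L1 : size (spell s1) <= L.
  by rewrite (leq_trans _ L12) // spell_cat size_cat leq_addr.
have [E1 {}E] := traject_negb_cat E L1.
have even1 : ~~ odd (size (spell s1)).
  by apply: spell_even; rewrite E1; apply: sorted_nand_traject.
have [|-> _] := traject_negb_cat (esym E); last first.
  by rewrite (negbTE even1) size_traject.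
by rewrite leq_subRL // -size_cat -spell_cat.
Qed.

Lemma size_letters n (w : word A) :
  width * n.+1 <= size (pr (eval f w)) -> n <= size w.2.
Proof.
rewrite pr_eval => /leq_trans/(_ (size_spell _)).
by rewrite leq_pmul2l // (leq_trans (pr_gt0 (f w.1))) ?size_pr.
Qed.

(** Among the first n.+1 letters of w, every block of letters but those
containing the first letter has an alternating value starting with e. *)
Definition phased n e (w : word A) := n <= size w.2 /\
  forall s1 s2 s3, letters w = s1 ++ s2 ++ s3 ->
    0 < size s1 -> size (s1 ++ s2) <= n.+1 ->
  spell s2 = traject negb e (size (spell s2)).

Lemma phasedW n n' e w : n <= n' -> phased n' e w -> phased n e w.
Proof.
move=> nn' [n'w ph]; split; first exact: leq_trans n'w.
move=> s1 s2 s3 Ew s1_gt0 ns; apply: (ph s1 s2 s3) => //.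
exact: leq_trans ns _.
Qed.

Lemma phased_traject n e L post w :
    pr (eval f w) = traject negb e L ++ post -> width * n.+1 <= L ->
  phased n e w.
Proof.
move=> E nL; split=> [|s1 s2 s3 Ew _ n12].
  apply: size_letters; rewrite (leq_trans nL) // E size_cat size_traject.
  exact: leq_addr.
apply: (@spell_segment _ L post s1 _ s3); rewrite -?Ew -?pr_eval //.
by rewrite (leq_trans _ nL) // leq_mul.
Qed.

(** No element reads 1, because its length would be odd; hence the first letter
of w absorbs the initial 11, and its length decides where the alternating block
is cut from then on. *)
Lemma phased_head n L post w :
    pr (eval f w) = true :: true :: traject negb false L ++ post ->
    width * n.+1 <= L ->
  phased n (odd (size (pr (f w.1)))) w.
Proof.
move=> E nL; split.
  apply: size_letters; rewrite (leq_trans nL) // E /= size_cat size_traject.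
  by rewrite -!addnS leq_addr.
case: w E => a s; rewrite pr_eval {1}/letters -cat1s spell_cat.
rewrite {1}/spell /= cats0 => E.
have aL : size (pr (f a)) <= L.
  by rewrite (leq_trans (size_pr a)) // (leq_trans _ nL) // leq_pmulr.
have [w Ea] : exists w, pr (f a) = true :: true :: w.
  move: (pr_gt0 (f a)) (@pr_even (f a)) E.
  case: (pr (f a)) => [|b [|c w]] //= _; first by move=> /(_ isT).
  by move=> _ [-> -> _]; exists w.
move: E (size_pr a) aL; rewrite Ea => -[/esym E] /= aK aL.
have [E1 Es] := traject_negb_cat E (ltnW (ltnW aL)).
move=> [|b s1] // s2 s3 [_ Ew] _ n12; rewrite addbF in Es; rewrite negbK.
apply: (@spell_segment _ (L - size w) post s1 _ s3); rewrite -?Ew //.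
rewrite leq_subRL; last exact: ltnW (ltnW aL).
rewrite (leq_trans _ nL) // (leq_trans _ (leq_mul (leqnn _) n12)) //= mulnS.
by rewrite leq_add2r; lia.
Qed.

(** What follows the first letter avoids 11, hence has even length. *)
Lemma odd_head (w : word A) z :
    pr (eval f w) = true :: true :: z -> sorted nand (true :: z) ->
  odd (size (pr (f w.1))) = odd (size (pr (eval f w))).
Proof.
case: w => a s; rewrite pr_eval /letters -cat1s spell_cat {1 3}/spell /= cats0.
move=> E z_nand; rewrite size_cat oddD.
suff /spell_even/negbTE-> : sorted nand (spell s) by rewrite addbF.
move: (pr_gt0 (f a)) E; case: (pr (f a)) => // b x _ [_ E].
have : sorted nand (x ++ spell s) by rewrite E.
by move=> /cat_sorted2[].
Qed.

(** Right or left multiplication by a fixed element behaves like this. *)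
Definition shifts (M : set (word (padded A))) (c d : nat) : Prop :=
  forall u v, M (convolution u v) ->
    size (pr (eval f u)) + c = size (pr (eval f v)) /\
    wt (eval f u) + d = wt (eval f v).

(** Pumping adds the same length and the same number of x to both values; two
alternating pieces with equal length and equal number of x start with the same
letter. *)
Lemma phase_unique M c d : regular M -> shifts M c d ->
  exists n, forall u v x y, M (convolution u v) ->
    phased n x u -> phased n y v -> x = y.
Proof.
move=> /regular_pumping[n Mn] Mcd; exists n => u v x y Muv [nu ux] [nv vy].
have [u' [v' [Muv' [s1 [s2 [s3 [s1_gt0 s2_gt0 ns Eu Eu']]]]]]] := Mn _ _ Muv nu nv.
move=> [t1 [t2 [t3 [t1_gt0 t2_gt0 nt Ev Ev']]]].
have := Mcd _ _ Muv; have := Mcd _ _ Muv'.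
rewrite !pr_eval !wt_eval Eu Eu' Ev Ev' !spell_cat !weigh_cat !size_cat.
move=> [Ez' Ew'] [Ez Ew].
have Ezz : size (spell s2) = size (spell t2) by lia.
have := weigh_traject (ux _ _ _ Eu s1_gt0 ns).
have := weigh_traject (vy _ _ _ Ev t1_gt0 nt).
have -> : weigh t2 = weigh s2 by lia.
rewrite -Ezz => -> /eqP; rewrite eqn_pmul2r ?spell_gt0 // => /eqP.
by move/cost_inj.
Qed.

Lemma phase_conflict M M' c d c' d' :
    regular M -> shifts M c d -> regular M' -> shifts M' c' d' ->
  ~ forall n, exists u v w x, [/\ M (convolution u w), M' (convolution v w),
      phased n false u, phased n true v & phased n x w].
Proof.
move=> rM sM rM' sM'; have [n nM] := phase_unique rM sM.
have [n' nM'] := phase_unique rM' sM'.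
move=> /(_ (n + n'))[u [v [w [x [Muw Mvw ph_u ph_v ph_w]]]]].
have := nM _ _ _ _ Muw (phasedW (leq_addr _ _) ph_u) (phasedW (leq_addr _ _) ph_w).
have := nM' _ _ _ _ Mvw (phasedW (leq_addl _ _) ph_v) (phasedW (leq_addl _ _) ph_w).
by move=> <-.
Qed.

(** No element has length 1, so those of length at most 3 are indecomposable. *)
Lemma generated_short (t : T) :
  generated (range f) t -> size (pr t) <= 3 -> exists a, f a = t.
Proof.
case=> [_ [a _ <-]|s t' _ _]; first by exists a.
have gt1 (r : T) : 1 < size (pr r).
  move: (pr_gt0 r) (@pr_even r).
  by case: (pr r) => [|b [|c w]] //= _ /(_ isT).
by have := gt1 s; have := gt1 t'; rewrite prM size_cat; lia.
Qed.

End Letters.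

Variables p q r : T.
Hypothesis pr_p : pr p = [:: true; true].
Hypothesis pr_q : pr q = [:: true; true; false].
Hypothesis pr_r : pr r = [:: false; true; true].
(** Dividing g by the last factor of either of its two factorizations,
or by the first factor, keeps only one of the two phases. *)
Hypothesis ambiguous : forall i, 0 < i -> exists2 g,
  pr g = [:: true; true] ++ traject negb false i.*2 ++
         nseq i.+1.*2 false ++ [:: true; true] &
  [/\ exists h, h * p = g, exists h, h * r = g,
      exists h, p * h = g & exists h, q * h = g]%g.

Lemma not_right_automatic : ~ right_automatic T.
Proof.
move=> [A [f [L [gen _ onto reg]]]].
have rep t : exists2 w, L w & eval f w = t.
  by have : [set: T]%classic t by []; rewrite -onto => -[w]; exists w.
have letter_of t : size (pr t) <= 3 -> exists a, f a = t.
  by apply: generated_short; rewrite gen.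
have right_shifts a : shifts f (right_lang f L (Some a)) (size (pr (f a))) (wt (f a)).
  by move=> u v /right_langP[_ _ <-]; rewrite prM wtM size_cat.
have [a Ea] : exists a, f a = p by apply: letter_of; rewrite pr_p.
have [b Eb] : exists b, f b = r by apply: letter_of; rewrite pr_r.
apply: (phase_conflict (reg (Some a)) (right_shifts a) (reg (Some b)) (right_shifts b)).
move=> n; pose i := (width f * n.+1).+1.
have ni : width f * n.+1 <= i.*2 by rewrite /i -addnn; lia.
have [g pr_g [[h hp] [k kr] _ _]] := ambiguous (ltn0Sn _ : 0 < i).
have [w Lw Ew] := rep g; have [u Lu Eu] := rep h; have [v Lv Ev] := rep k.
have pr_h : pr h = [:: true; true] ++ traject negb false i.*2 ++ nseq i.+1.*2 false.
  by apply: (@catIs _ [:: true; true]); rewrite -{1}pr_p -prM hp pr_g !catA.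
have pr_k : pr k = [:: true; true] ++ traject negb false i.*2 ++ nseq i.*2.+1 false.
  apply: (@catIs _ [:: false; true; true]); rewrite -{1}pr_r -prM kr pr_g.
  by rewrite doubleS -[i.*2.+2]addn1 nseqD -!catA.
(* The length of h is even and that of k is odd, which fixes their phases. *)
have nand_z m : sorted nand (true :: traject negb false i.*2 ++ nseq m false).
  exact: (@sorted_nand_nseq _ m (sorted_nand_traject true i.*2.+1)).
exists u, v, w, (odd (size (pr (f w.1)))); split.
- by apply/right_langP; rewrite Eu Ea Ew.
- by apply/right_langP; rewrite Ev Eb Ew.
- suff <- : odd (size (pr (f u.1))) = false.
    by apply: phased_head ni; rewrite Eu pr_h.
  rewrite (odd_head _ (nand_z i.+1.*2)) Eu pr_h //.
  by rewrite !size_cat size_traject size_nseq /= -doubleD odd_double.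
- suff <- : odd (size (pr (f v.1))) = true.
    by apply: phased_head ni; rewrite Ev pr_k.
  rewrite (odd_head _ (nand_z i.*2.+1)) Ev pr_k //.
  by rewrite !size_cat size_traject size_nseq /= addnS -doubleD /= odd_double.
- by apply: phased_head ni; rewrite Ew pr_g.
Qed.

Lemma not_left_automatic : ~ left_automatic T.
Proof.
move=> [A [f [L [gen _ onto reg]]]].
have rep t : exists2 w, L w & eval f w = t.
  by have : [set: T]%classic t by []; rewrite -onto => -[w]; exists w.
have letter_of t : size (pr t) <= 3 -> exists a, f a = t.
  by apply: generated_short; rewrite gen.
have left_shifts a : shifts f (left_lang f L (Some a)) (size (pr (f a))) (wt (f a)).
  by move=> u v /left_langP[_ _ <-]; rewrite prM wtM size_cat; split; apply: addnC.
have [a Ea] : exists a, f a = p by apply: letter_of; rewrite pr_p.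
have [b Eb] : exists b, f b = q by apply: letter_of; rewrite pr_q.
apply: (phase_conflict (reg (Some a)) (left_shifts a) (reg (Some b)) (left_shifts b)).
move=> n; pose i := width f * n.+1.
have ni : width f * n.+1 <= i.*2.+1 by rewrite -addnn -addnS leq_addr.
have [g pr_g [_ _ [h ph] [k qk]]] := ambiguous (ltn0Sn i).
have [w Lw Ew] := rep g; have [u Lu Eu] := rep h; have [v Lv Ev] := rep k.
have pr_h : exists z, pr h = traject negb false i.*2.+1 ++ z.
  move: pr_g; rewrite -ph prM pr_p doubleS trajectSr -cats1 -catA => -[->].
  by eexists.
have pr_k : exists z, pr k = traject negb true i.*2.+1 ++ z.
  by move: pr_g; rewrite -qk prM pr_q doubleS trajectS => -[->]; eexists.
(* The block now comes first, so its first letter is the phase. *)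
have [y Ey] := pr_h; have [z Ez] := pr_k.
exists u, v, w, (odd (size (pr (f w.1)))); split.
- by apply/left_langP; rewrite Eu Ea Ew.
- by apply/left_langP; rewrite Ev Eb Ew.
- by apply: phased_traject ni; rewrite Eu Ey.
- by apply: phased_traject ni; rewrite Ev Ez.
- by apply: (phased_head _ (leq_trans ni (leqnSn _))); rewrite Ew pr_g.
Qed.

End Core.

(** * Finitely generated subsemigroups and powers *)

Section GeneratedSemigroup.
Variables (S : semigroupType) (X : seq S).

Definition generatedb : pred S := fun s => `[< generated [set` X] s >].

Lemma generatedb_mul : mulg_closed generatedb.
Proof. by move=> s t /asboolP Xs /asboolP Xt; apply/asboolP/gen_mul. Qed.

HB.instance Definition _ :=
  SubChoice_isSubSemigroup.Build S generatedb {s | generatedb s} generatedb_mul.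

Definition generated_semigroup : subSemigroupType generatedb :=
  {s | generatedb s}.

Lemma sub_generated s : s \in X -> generatedb s.
Proof. by move=> Xs; apply/asboolP/gen_mem. Qed.

Lemma generated_semigroup_fg : finitely_generated generated_semigroup.
Proof.
pose elt s (Ps : generatedb s) : generated_semigroup := exist _ s Ps.
exists (pmap insub X); rewrite -subTset => -[s Ps] _; have /asboolP Xs := Ps.
elim: Xs Ps => {s} [s Xs|s t Xs IHs Xt IHt] Ps.
  by apply: gen_mem; have /= -> := mem_pmap_sub X (elt s Ps).
have Ps' : generatedb s by apply/asboolP.
have Pt : generatedb t by apply/asboolP.
have E : elt _ Ps = (elt s Ps' * elt t Pt)%g by apply: val_inj.
by rewrite -[exist _ _ _]/(elt _ Ps) E; apply: gen_mul.
Qed.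

End GeneratedSemigroup.

Section RightPowers.
Variable S : semigroupType.
Implicit Types s t u y z : S.

(** The element s t^i. A semigroup has no power t^0, hence the left factor
s. *)
Definition rpow s t i : S := iter i (fun u => u * t)%g s.

Lemma rpowSr s t i : rpow s t i.+1 = rpow (s * t)%g t i.
Proof. exact: iterSr. Qed.

Lemma mul_rpow s t u i : (s * rpow t u i = rpow (s * t) u i)%g.
Proof. by elim: i => //= i <-; rewrite mulgA. Qed.

Lemma rpow_shift s t y i : (rpow (s * y) (t * y) i = rpow s (y * t) i * y)%g.
Proof. by elim: i => //= i ->; rewrite !mulgA. Qed.

Lemma rpow_mulC s t z i : commute z t -> (rpow s z i * t = rpow (s * t) z i)%g.
Proof. by move=> zt; elim: i => //= i <-; rewrite -!mulgA zt. Qed.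

Lemma rpow_rpowC s t z i k : commute z t ->
  rpow (rpow s z i) t k = rpow (rpow s t k) z i.
Proof. by move=> zt; elim: k => //= k ->; rewrite rpow_mulC. Qed.

Lemma rpowM s t z i : commute z t -> rpow s (t * z)%g i = rpow (rpow s t i) z i.
Proof. by move=> zt; elim: i => //= i ->; rewrite mulgA (rpow_mulC _ _ zt). Qed.

End RightPowers.

(** * Reading elements of S(m,m) *)

Section Scan.
Variable m : nat.
Hypothesis m_gt1 : 1 < m.

Let m_gt0 : 0 < m := ltnW m_gt1.

(** A word acts on states by being read from right to left: c counts modulo m
the x met since the last y, l records for each y whether the count that followed
it was nonzero, and n counts all x. As an action, it is compatible with
concatenation. *)
Definition state : Type := (nat * seq bool * nat)%type.

Definition scan (g : BSgen) (s : state) : state :=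
  let: (c, l, n) := s in
  if g is BSx then (c.+1 %% m, l, n.+1) else (0, (0 < c %% m) :: l, n).

Definition act (u : word BSgen) (s : state) : state := foldr scan s (letters u).

Lemma act_wcat u v s : act (wcat u v) s = act u (act v s).
Proof. by rewrite /act /letters /= foldr_cat. Qed.

Lemma scan_nseq k c l n : 0 < k ->
  foldr scan (c, l, n) (nseq k BSx) = ((c + k) %% m, l, n + k).
Proof.
elim: k => // -[|k] IH _; first by rewrite /= !addn1.
by rewrite /= in IH *; rewrite IH //= -addn1 modnDml addn1 -!addnS.
Qed.

(** On the state (c, l, n), both y x^m and x^m y reset the first counter, record
whether c is a multiple of m, and add m to n. *)
Lemma act_congruence u v :
  congruence (BSrel m) u v -> forall s, act u s = act v s.
Proof.
elim=> {u v} [u v [-> ->]|u|u v _ IH|u v w _ IH1 _ IH2|u u' v v' _ IH1 _ IH2] s //.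
- case: s => [[c l] n]; rewrite /act /letters -rcons_cons.
  have -> : BSx :: nseq m.-1 BSx = nseq m BSx by rewrite -{2}(prednK m_gt0).
  by rewrite -cats1 foldr_cat /= !scan_nseq //= add0n modnn modnDr modn_mod.
- by rewrite IH1.
- by rewrite !act_wcat IH2 IH1.
Qed.

Local Notation S := (BS m).

Definition actS (s : S) (st : state) : state := act (repr s) st.

Lemma actS_pi u st : actS (\pi_(BS m)%qT u) st = act u st.
Proof. by apply: act_congruence; apply/pi_presentedP; rewrite reprK. Qed.

Lemma actSM (s t : S) st : actS (s * t)%g st = actS s (actS t st).
Proof. by rewrite [LHS]actS_pi act_wcat. Qed.

Definition X : S := \pi_(BS m)%qT (letter BSx).
Definition Y : S := \pi_(BS m)%qT (letter BSy).
Definition Z : S := \pi_(BS m)%qT (BSx, nseq m.-1 BSx).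

Lemma actX c l n : actS X (c, l, n) = (c.+1 %% m, l, n.+1).
Proof. by rewrite actS_pi. Qed.

Lemma actY c l n : actS Y (c, l, n) = (0, (0 < c %% m) :: l, n).
Proof. by rewrite actS_pi. Qed.

Lemma actZ c l n : actS Z (c, l, n) = (c %% m, l, n + m).
Proof.
rewrite actS_pi /act /letters -[_ :: _]/(nseq m.-1.+1 BSx) prednK //.
by rewrite scan_nseq // modnDr.
Qed.

Lemma commZX : commute Z X.
Proof.
apply: (etrans (esym (pi_wcat _ _ _)) (etrans _ (pi_wcat _ _ _))).
by congr (\pi_(BS m)%qT (_, _)); rewrite /letters /= -[RHS]/(nseq m.-1.+1 BSx) -addn1 nseqD.
Qed.

Lemma commZY : commute Z Y.
Proof.
apply: (etrans (esym (pi_wcat _ _ _)) (etrans _ (pi_wcat _ _ _))).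
apply/pi_presentedP/cong_sym/cong_rel; split; last by rewrite /wcat cats1.
by rewrite /wcat /letters /= -[_ :: _]/(nseq m.-1.+1 BSx) prednK.
Qed.

(** * The seven generators *)

Definition gp : S := (Y * X * (Y * X))%g.
Definition gq : S := (gp * Y)%g.
Definition gr : S := (Y * gp)%g.
Definition gb : S := (Y * Y * X * Z)%g.
Definition ge : S := (Y * X * Y)%g.
Definition gb' : S := (Y * Y)%g.
Definition ge' : S := (Y * Y * Z)%g.

(** Reading starts with the counter c at 0: this is why words of products are
concatenated. It fits the elements that start with y. *)
Definition reads (s : S) (w : seq bool) (n : nat) : Prop :=
  forall l k, actS s (0, l, k) = (0, w ++ l, n + k).

Lemma readsM s t w w' n n' :
  reads s w n -> reads t w' n' -> reads (s * t)%g (w ++ w') (n + n').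
Proof. by move=> sw tw l k; rewrite actSM tw sw catA addnA. Qed.

(** The number of x in a pair of letters: 10 is yxy, and 01 is yyx followed by
x^m. *)
Definition cost (e : bool) : nat := if e then 1 else m.+1.

(** The shape of the words of T which the phase argument needs; it is
inherited by products. *)
Definition tame (w : seq bool) (n : nat) : Prop :=
  [/\ 0 < size w, sorted nand w -> ~~ odd (size w)
    & forall e, w = traject negb e (size w) -> n.*2 = cost e * size w].

(** A factor of a word without 11 has no 11; two factors of even length of an
alternating word start with the same letter. *)
Lemma tameM w w' n n' : tame w n -> tame w' n' -> tame (w ++ w') (n + n').
Proof.
move=> [w_gt0 w_even w_cost] [_ w'_even w'_cost]; split.
- by rewrite size_cat ltn_addr.
- move=> /cat_sorted2[/w_even ow /w'_even ow'].
  by rewrite size_cat oddD (negbTE ow).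
- move=> e Ew; have [||Ew1 Ew2] := @traject_negb_cat e (size (w ++ w')) w w' [::].
  + by rewrite cats0.
  + by rewrite size_cat leq_addr.
  have ow : ~~ odd (size w) by apply: w_even; rewrite Ew1 sorted_nand_traject.
  rewrite cats0 (negbTE ow) size_cat addKn in Ew2.
  by rewrite size_cat doubleD mulnDr (w_cost e) // (w'_cost e).
Qed.

Definition readings : seq (S * (seq bool * nat)) :=
  [:: (gp, ([:: true; true], 2)); (gq, ([:: true; true; false], 2));
      (gr, ([:: false; true; true], 2)); (gb, ([:: false; true], m.+1));
      (ge, ([:: true; false], 1)); (gb', ([:: false; false], 0));
      (ge', ([:: false; false], m))].

Lemma readingsP s w n : (s, (w, n)) \in readings -> reads s w n /\ tame w n.
Proof.
have modS : 1 %% m = 1 by rewrite modn_small.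
rewrite !inE => E; repeat case/orP: E => E;
  case/eqP: E => -> -> ->; split;
  try by [move=> l k; rewrite !actSM ?(actX, actY, actZ, modS, mod0n, modn_mod) //=;
    congr (_, _); lia | split=> // -[] //= _; rewrite /cost; lia].
Qed.

Definition gens : seq S := unzip1 readings.

Local Notation T := (generated_semigroup gens).

Lemma readable (t : T) : exists w n, reads (val t) w n /\ tame w n.
Proof.
case: t => s /= /asboolP Ts; elim: Ts => {s} [s gs|s t _].
  have /mapP[[s' [w n]] /readingsP rw ->] : s \in unzip1 readings by [].
  by exists w, n.
move=> [w [n [sw wn]]] _ [w' [n' [tw' wn']]].
by exists (w ++ w'), (n + n'); split; [apply: readsM|apply: tameM].
Qed.

Definition pr (t : T) : seq bool := (actS (val t) (0, [::], 0)).1.2.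
Definition wt (t : T) : nat := (actS (val t) (0, [::], 0)).2.

Lemma readsE t w n : reads (val t) w n -> pr t = w /\ wt t = n.
Proof. by rewrite /pr /wt => ->; rewrite cats0 addn0. Qed.

Lemma readsP t : reads (val t) (pr t) (wt t) /\ tame (pr t) (wt t).
Proof. by have [w [n [tw wn]]] := readable t; have [-> ->] := readsE tw. Qed.

Lemma mulE s t : pr (s * t)%g = pr s ++ pr t /\ wt (s * t)%g = wt s + wt t.
Proof. by apply: readsE; apply: readsM; have [] := readsP s; have [] := readsP t. Qed.

Lemma pr_rpow s t e i w : pr t = [:: e; ~~ e] -> pr s = w ->
  pr (rpow s t i) = w ++ traject negb e i.*2.
Proof.
move=> Et Es; elim: i => [|i IH]; first by rewrite cats0.
have [-> _] := mulE (rpow s t i) t; rewrite IH Et -catA.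
have -> : [:: e; ~~ e] = traject negb (iter i.*2 negb e) 2.
  by elim: (i) => //= k; rewrite negbK.
by rewrite -trajectD addn2.
Qed.

Lemma pr_rpow_false s t i w : pr t = [:: false; false] -> pr s = w ->
  pr (rpow s t i) = w ++ nseq i.*2 false.
Proof.
move=> Et Es; elim: i => [|i IH]; first by rewrite cats0.
have [-> _] := mulE (rpow s t i) t; rewrite IH Et -catA.
by rewrite -[[:: _; _]]/(nseq 2 false) -nseqD addn2.
Qed.

(** Since q = p y, r = y p and y (yxy) = (yyx) y, the letter y that
ends q travels through e^i and e'^i and completes a last b' in front of p;
the central factors z are gathered at the end. *)
Lemma two_factorizations i :
  (rpow (rpow gp gb i) gb' i.+1 * gp)%g = (rpow (rpow gq ge i) ge' i * gr)%g.
Proof.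
have [ZX ZY] := (commZX, commZY).
have ZYY : commute Z gb' by apply: commuteM.
have ZYYX : commute Z (Y * Y * X)%g by apply: commuteM.
have Zgp : commute Z gp by do !apply: commuteM.
have Zgr : commute Z gr by apply: commuteM.
rewrite /gb (rpowM _ _ ZYYX) (rpow_rpowC _ _ _ ZYY) (rpow_mulC _ _ Zgp).
rewrite /gq /ge rpow_shift mulgA -/gb' (rpowM _ _ ZYY) (rpow_mulC _ _ Zgr).
by rewrite /gb' rpow_shift /= /gr !mulgA.
Qed.

Lemma val_rpow (s t : T) i : val (rpow s t i) = rpow (val s) (val t) i.
Proof. by elim: i => //= i <-. Qed.

Lemma generator s w n : (s, (w, n)) \in readings ->
  exists2 t : T, val t = s & pr t = w.
Proof.
move=> sw; have gs : s \in gens by apply/mapP; exists (s, (w, n)).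
pose t : T := exist _ s (sub_generated gs); exists t => //.
by have [rs _] := readingsP sw; have [] := @readsE t w n rs.
Qed.

Lemma not_automatic : ~ right_automatic T /\ ~ left_automatic T.
Proof.
have cost_inj : injective cost.
  by case=> - [] //; rewrite /cost; move: m_gt0; lia.
have prM s t : pr (s * t)%g = pr s ++ pr t := proj1 (mulE s t).
have wtM s t : wt (s * t)%g = wt s + wt t := proj2 (mulE s t).
have pr_gt0 t : 0 < size (pr t) by have [_ []] := readsP t.
have pr_even t : sorted nand (pr t) -> ~~ odd (size (pr t)).
  by have [_ []] := readsP t.
have wt_traject t e : pr t = traject negb e (size (pr t)) ->
    (wt t).*2 = cost e * size (pr t).
  by have [_ [_ _]] := readsP t; apply.
have [p Ep pr_p] := @generator gp [:: true; true] 2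
  ltac:(by rewrite !inE eqxx ?orbT).
have [q Eq pr_q] := @generator gq [:: true; true; false] 2
  ltac:(by rewrite !inE eqxx ?orbT).
have [r Er pr_r] := @generator gr [:: false; true; true] 2
  ltac:(by rewrite !inE eqxx ?orbT).
have [b Eb pr_b] := @generator gb [:: false; true] m.+1
  ltac:(by rewrite !inE eqxx ?orbT).
have [e Ee pr_e] := @generator ge [:: true; false] 1
  ltac:(by rewrite !inE eqxx ?orbT).
have [b' Eb' pr_b'] := @generator gb' [:: false; false] 0
  ltac:(by rewrite !inE eqxx ?orbT).
have [e' Ee' pr_e'] := @generator ge' [:: false; false] m
  ltac:(by rewrite !inE eqxx ?orbT).
have ambiguous i : 0 < i -> exists2 g,
    pr g = [:: true; true] ++ traject negb false i.*2 ++
           nseq i.+1.*2 false ++ [:: true; true] &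
    [/\ exists h, h * p = g, exists h, h * r = g,
        exists h, p * h = g & exists h, q * h = g]%g.
  case: i => // i _; exists (rpow (rpow p b i.+1) b' i.+2 * p)%g.
    rewrite prM (pr_rpow_false _ pr_b' (pr_rpow _ pr_b pr_p)) pr_p.
    by rewrite -!catA.
  have Eg : (rpow (rpow p b i.+1) b' i.+2 * p = rpow (rpow q e i.+1) e' i.+1 * r)%g.
    apply: val_inj.
    have valM (s t : T) : val (s * t)%g = (val s * val t)%g by [].
    by rewrite !valM !val_rpow Ep Eb Eb' Eq Ee Ee' Er; apply: (two_factorizations i.+1).
  split.
  - by exists (rpow (rpow p b i.+1) b' i.+2).
  - by exists (rpow (rpow q e i.+1) e' i.+1); rewrite Eg.
  - exists (rpow (rpow b b i) b' i.+2 * p)%g.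
    by rewrite mulgA !mul_rpow (rpowSr p).
  - exists (rpow (rpow e e i) e' i.+1 * r)%g.
    by rewrite Eg mulgA !mul_rpow (rpowSr q).
split.
  exact: (not_right_automatic cost_inj prM wtM pr_gt0 pr_even wt_traject pr_p pr_r ambiguous).
exact: (not_left_automatic cost_inj prM wtM pr_gt0 pr_even wt_traject pr_p pr_q ambiguous).
Qed.

End Scan.

(** * The theorem *)

Theorem mainTheorem3 (m : nat) (hm : (2 <= m)%N) :
  exists (P : pred (BS m)) (T : subSemigroupType P),
    finitely_generated T /\ ~ right_automatic T /\ ~ left_automatic T.
Proof.
exists _, (generated_semigroup (gens m)).
split; [exact: generated_semigroup_fg | exact: not_automatic].
Qed.
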